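(* Let $k\ge 1$ be a constant. There is a constant $C_k$ such that for every $n$ there exists a graph $G$ with at most $C_k n^k$ nodes such that every graph on $n$ nodes with arboricity $k$ is isomorphic to a node-induced subgraph of $G$.
   Context: A graph has arboricity $k$ if its edge set can be partitioned into at most $k$ forests. A graph $H=(V',E')$ is a node-induced subgraph of $G=(V,E)$ if $V'\subseteq V$ and $E'=\{\{v,w\}: v,w\in V',\ \{v,w\}\in E\}$. *)

(* Defs.v *)
From HB Require Import structures.
From mathcomp Require Import all_boot.

Set Implicit Arguments.
Unset Strict Implicit.
Unset Printing Implicit Defensive.

Record sgraph := SGraph {
  vertex :> finType;
  adj : rel vertex;
  adj_sym : symmetric adj;
  adj_irr : irreflexive adj }.

Definition edges (G : sgraph) : {set {set G}} :=
  [set e | [exists x, exists y, (e == [set x; y]) && adj x y]].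

(* [ucycle] also accepts x :: y :: nil as a cycle when {x, y} is in [F] (an edge
   walked back and forth); a graph cycle has at least three nodes. *)
Definition acyclic_edges (V : finType) (F : {set {set V}}) : Prop :=
  forall c : seq V, 2 < size c -> ~ ucycle (fun x y => [set x; y] \in F) c.

(* The blocks of a [partition] are nonempty, so [#|P|] may be anything from 0
   (no edges) to [k]. *)
Definition has_arboricity (k : nat) (G : sgraph) : Prop :=
  exists P : {set {set {set G}}},
    [/\ partition P (edges G), #|P| <= k &
        forall F, F \in P -> acyclic_edges F].

Section Induced.
Variables (G : sgraph) (A : {set G}).

Definition induced_adj : rel {x : G | x \in A} :=
  fun u v => adj (val u) (val v).

Lemma induced_adj_sym : symmetric induced_adj.
Proof. by move=> u v; apply: adj_sym. Qed.

Lemma induced_adj_irr : irreflexive induced_adj.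
Proof. by move=> u; apply: adj_irr. Qed.

Definition induced : sgraph := SGraph induced_adj_sym induced_adj_irr.
End Induced.

Definition isomorphic (G H : sgraph) : Prop :=
  exists2 f : G -> H, bijective f & forall x y, adj (f x) (f y) = adj x y.

(* Main.v *)
(* An n-node graph of arboricity k is the union of k forests on its node set, so
   the k-th power of an induced-universal graph for n-node forests, with two
   tuples adjacent when some coordinates are, is universal for it. It remains to
   find an induced-universal graph with O(n) nodes for n-node forests, that is,
   adjacency labels of log n + O(1) bits.

   Cut the forest recursively: from a piece C remove a bag of at most 7 nodes
   (the nodes with a neighbour outside C and two weighted centroids), so that
   every component of the rest has at most |C|/2 nodes and is again attached to
   the outside by a bounded number of edges. Every edge then joins two nodes of
   one bag or of a bag and its parent bag, and sizes at least halve along the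
   tree of bags, so it suffices to label the bags so that the parent relation
   can be decided.

   A piece C of class i = floor (log |C|) receives an interval of length O(|C|)
   starting at a multiple of grain i, which is about 2^i / i^3: this keeps the
   total waste bounded and frees about i - 3 log i bits in the label. The
   children of C are grouped by class into consecutive blocks, each a whole
   number of grains. For a child of class j there are two cases:
   - i < 2^(j/16): the child has room to store i and its distance, in grains, to
     the start of the parent;
   - otherwise j = O(log i), and the parent has room to store the boundaries of
     the blocks of all such classes, which takes O((log i)^2) bits; a bag of
     class j in the j-th block is a child, since deeper bags located there have
     smaller class.
   So O(n / 2^(i/2)) labels suffice for class i, and their sum is O(n). *)

Require Import Defs.
From HB Require Import structures.
From mathcomp Require Import all_boot.
From mathcomp Require Import zify.

Set Implicit Arguments.
Unset Strict Implicit.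
Unset Printing Implicit Defensive.

(** * Rooted forests and separators *)

(** If every node of [S] had two neighbours in [S], a path could grow forever at its head: a
    neighbour other than the preceding node is new or closes a cycle. *)
Lemma acyclic_leaf (V : finType) (e : rel V) (S : {set V}) :
  symmetric e -> irreflexive e -> (forall c, 2 < size c -> ~ ucycle e c) ->
  S != set0 -> exists2 x, x \in S & #|[set y in S | e x y]| <= 1.
Proof.
move=> esym eirr acy /set0Pn[x0 x0S].
have [/exists_inP[x xS dx]|/exists_inPn deg2] :=
  boolP [exists x in S, #|[set y in S | e x y]| <= 1]; first by exists x.
suff long m : exists x p, [/\ size p = m, path e x p, uniq (x :: p) & {subset x :: p <= S}].
  have [x [p [sp _ up _]]] := long #|V|.
  by have := max_card (mem (x :: p)); rewrite (card_uniqP up) /= sp ltnn.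
elim: m => [|m [x [p [sp ep up pS]]]].
  by exists x0, [::]; split=> // y; rewrite inE => /eqP->.
have xS : x \in S by apply: pS; rewrite inE eqxx.
have [z [zS exz zh]] : exists z, [/\ z \in S, e x z & z != head x p].
  have := deg2 _ xS; rewrite -ltnNge => /card_gt1P[y [z []]].
  rewrite !inE => /andP[yS exy] /andP[zS exz] yz.
  have [yh|yh] := eqVneq y (head x p); last by exists y.
  by exists z; split=> //; rewrite -yh eq_sym.
have zx : z != x by apply: contraTneq exz => ->; rewrite eirr.
have [zp|zp] := boolP (z \in p).
  case: p sp ep up pS zh zp => // y p _ /= /andP[exy ep] up _ zy.
  rewrite inE (negPf zy) /= => zp; exfalso.
  case/splitPr: zp ep up => p1 p2.
  rewrite cat_path /= => /and3P[ep1 ez _] up.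
  apply: (acy (x :: y :: rcons p1 z)); first by rewrite /= size_rcons.
  apply/andP; split; last first.
    apply: (@subseq_uniq _ _ [:: x, y & p1 ++ z :: p2]) => //; rewrite -cat_rcons /= !eqxx.
    exact: prefix_subseq.
  by rewrite /= exy /= !rcons_path last_rcons ep1 ez esym exz.
exists z, (x :: p); split=> /=; first by rewrite sp.
- by rewrite esym exz.
- by move: up => /= ->; rewrite inE negb_or zx zp.
- by move=> t; rewrite inE => /orP[/eqP->|/pS].
Qed.

(** Induction removes a leaf, takes its remaining neighbour, if any, as its parent, and ranks it
    below all others. *)
Lemma acyclic_rooted (V : finType) (e : rel V) :
  symmetric e -> irreflexive e -> (forall c, 2 < size c -> ~ ucycle e c) ->
  exists (par : V -> option V) (rk : V -> nat),
    (forall x y, e x y = (par x == Some y) || (par y == Some x)) /\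
    (forall x y, par x = Some y -> rk x < rk y).
Proof.
move=> esym eirr acy.
suff H m : forall S : {set V}, #|S| = m -> exists (par : V -> option V) (rk : V -> nat),
    [/\ {in S &, forall x y, e x y = (par x == Some y) || (par y == Some x)},
      forall x y, x \in S -> par x = Some y -> y \in S &
      forall x y, x \in S -> par x = Some y -> rk x < rk y].
  have [par [rk [h1 h2 h3]]] := H #|V| setT (cardsT V).
  by exists par, rk; split=> [x y|x y]; [apply: h1|apply: h3]; rewrite inE.
elim: m => [|m IH] S cS.
  exists (fun _ => None), (fun _ => 0).
  by move/eqP: cS; rewrite cards_eq0 => /eqP->; split=> x y; rewrite inE.
have S0 : S != set0 by rewrite -card_gt0 cS.
have [x xS dx] := acyclic_leaf esym eirr acy S0.
have [par [rk [h1 h2 h3]]] := IH (S :\ x) ltac:(by move: cS; rewrite (cardsD1 x) xS => -[]).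
pose px := [pick y in S | e x y].
exists (fun v => if v == x then px else par v), (fun v => if v == x then 0 else (rk v).+1).
have pxP y : y \in S -> (px == Some y) = e x y.
  move=> yS; rewrite /px; case: pickP => [z /andP[zS xz]|/(_ y)]; last by rewrite yS /= => ->.
  apply/eqP/idP => [[<-//]|xy].
  by congr Some; apply: (card_le1_eqP dx); rewrite !inE ?zS ?yS.
have parx v : v \in S -> v != x -> par v == Some x = false.
  by move=> vS vx; apply/eqP => /(h2 _ _ _); rewrite !inE eqxx vx vS; move/(_ isT).
split.
- move=> v w vS wS; have [->|vx] := eqVneq v x; have [->|wx] := eqVneq w x.
  + by rewrite pxP // eirr.
  + by rewrite pxP // parx // orbF.
  + by rewrite esym pxP // parx.
  + by rewrite h1 // !inE ?vx ?wx.
- move=> v w vS; case: eqP => [_|/eqP vx].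
    by rewrite /px; case: pickP => // z /andP[zS _] [<-].
  by move/h2; rewrite !inE vx vS => /(_ isT)/andP[].
- move=> v w vS; have [_|vx] := eqVneq v x; last first.
    move=> pv; have := h2 _ _ _ pv; rewrite !inE vx vS => /(_ isT)/andP[wx _].
    by rewrite (negPf wx) ltnS; apply: h3 pv; rewrite !inE vx.
  rewrite /px; case: pickP => // z /andP[zS xz] [<-].
  by have [zx|//] := eqVneq z x; rewrite zx eirr in xz.
Qed.

Section Rooted.
Variables (V : finType) (par : V -> option V) (rk : V -> nat).
Hypothesis rk_par : forall x y, par x = Some y -> rk x < rk y.

Definition up : rel V := fun x y => par x == Some y.
Definition desc (v : V) : {set V} := [set x | connect up x v].

Lemma desc_rk v x : x \in desc v -> x != v -> rk x < rk v.
Proof.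
rewrite inE => /connectP[p pp ->].
elim: p x pp => [|y p IH] x /=; first by rewrite eqxx.
case/andP=> /eqP/rk_par xy /IH{}IH _.
by have [<-//|/IH/(ltn_trans xy)] := eqVneq y (last y p).
Qed.

Lemma desc_up v x y : x \in desc v -> x != v -> par x = Some y -> y \in desc v.
Proof.
rewrite !inE => /connectP[[|z p] /=]; first by move=> _ ->; rewrite eqxx.
case/andP=> /eqP-> pp -> _ [<-]; apply/connectP; by exists p.
Qed.

(* [top S x] is the root of the component of x in the forest restricted to S. *)
Definition climb (S : {set V}) (x : V) : V :=
  if par x is Some y then if y \in S then y else x else x.
Definition top (S : {set V}) (x : V) : V := iter (\max_v rk v).+1 (climb S) x.

Lemma climb_rk (S : {set V}) x : climb S x = x \/ rk x < rk (climb S x).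
Proof.
rewrite /climb; case E: (par x) => [y|]; last by left.
by case: ifP => _; [right; apply: rk_par|left].
Qed.

(** Every climb that moves raises the rank, so more steps than the largest rank reach a fixed
    point. *)
Lemma climb_top (S : {set V}) x : climb S (top S x) = top S x.
Proof.
suff H n : climb S (iter n (climb S) x) = iter n (climb S) x \/ n <= rk (iter n (climb S) x).
  have [//|] := H (\max_v rk v).+1.
  by rewrite -/(top S x) => /leq_trans/(_ (leq_bigmax (top S x))); rewrite ltnn.
elim: n => [|n [IH|IH]]; [by right|by left; rewrite !iterS !IH|].
rewrite !iterS; have [cz|cz] := climb_rk S (iter n (climb S) x).
  by left; rewrite !cz.
by right; apply: leq_ltn_trans IH cz.
Qed.

Lemma top_climb (S : {set V}) x : top S (climb S x) = top S x.
Proof. by rewrite /top -iterSr iterS; apply: climb_top. Qed.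

Lemma top_par (S : {set V}) x y : par x = Some y -> y \in S -> top S x = top S y.
Proof. by move=> xy yS; rewrite -top_climb {1}/climb xy yS. Qed.

Lemma top_exit (S : {set V}) x y : par x = Some y -> y \notin S -> top S x = x.
Proof.
by move=> xy yS; apply: iter_fix; rewrite /climb xy (negPf yS).
Qed.

Lemma top_ind (S : {set V}) x (P : V -> Prop) :
  P x -> (forall z y, P z -> par z = Some y -> y \in S -> P y) -> P (top S x).
Proof.
move=> Px step; rewrite /top; elim: _.+1 => // n IH; rewrite iterS.
move: IH; move: (iter n _ _) => z Pz; rewrite /climb; case E: (par z) => [y|//].
by case: ifP => // yS; apply: step E yS.
Qed.

Lemma top_in (S : {set V}) x : x \in S -> top S x \in S.
Proof. by move=> xS; apply: (@top_ind S x (fun z => z \in S)). Qed.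

Lemma desc_top (S : {set V}) x : x \in desc (top S x).
Proof.
apply: (@top_ind S x (fun z => x \in desc z)) => [|z y]; rewrite !inE ?connect0 // => xz zy _.
by apply: connect_trans xz (connect1 _); apply/eqP.
Qed.

(** A walk towards the root leaves the subtree of [c] only through [c], which [S] excludes. *)
Lemma top_desc (S : {set V}) c x : c \notin S -> x \in S -> x \in desc c -> top S x \in desc c.
Proof.
move=> cS xS xc; have: x \in S /\ x \in desc c by [].
move/(@top_ind S x (fun z => z \in S /\ z \in desc c)) => H.
apply: (proj2 (H _)) => z y [zS zc] zy yS; split=> //; apply: desc_up zc _ zy.
by apply: contraNneq cS => <-.
Qed.

Definition par_in (K : {set V}) (x : V) : bool := oapp (fun y => y \in K) false (par x).

Lemma par_inP (K : {set V}) x : reflect (exists2 y, par x = Some y & y \in K) (par_in K x).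
Proof.
rewrite /par_in; case: (par x) => [y|] /=; last by constructor; case.
by apply: (iffP idP) => [yK|[z [<-]//]]; exists y.
Qed.

Definition comp (S : {set V}) (t : V) : {set V} := [set x in S | top S x == t].

(* Besides its own nodes, a component is charged for the nodes whose parent lies
   in it: these are the attachments counted by the second centroid of
   [piece_split]. *)
Lemma centroid (C : {set V}) (w : V -> nat) (x0 : V) :
  exists c, forall (S : {set V}) t, S \subset C -> c \notin S ->
    2 * (\sum_(z in C | (z != c) && ((z \in comp S t) || par_in (comp S t) z)) w z)
    <= \sum_(z in C) w z.
Proof.
pose heavy c := \sum_(z in C) w z < 2 * \sum_(z in C :&: desc c) w z.
have compP (S : {set V}) t z : (z \in comp S t) || par_in (comp S t) z -> z \in desc t.
  case/orP => [|/par_inP[y zy]]; rewrite inE => /andP[_ /eqP<-]; first exact: desc_top.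
  have := desc_top S y; rewrite !inE; apply: connect_trans; apply: connect1; exact/eqP.
have half (S : {set V}) t c : ~~ heavy t ->
    2 * (\sum_(z in C | (z != c) && ((z \in comp S t) || par_in (comp S t) z)) w z)
    <= \sum_(z in C) w z.
  rewrite -leqNgt; apply: leq_trans; rewrite leq_mul2l /=.
  rewrite [leqRHS](eq_bigl (fun z => (z \in C) && (z \in desc t))); last by move=> z; rewrite inE.
  rewrite [leqLHS]big_mkcondr [leqRHS]big_mkcondr /=; apply: leq_sum => z _.
  by case: (boolP (_ || _)) => [/compP->|]; rewrite ?andbF ?andbT //; case: ifP.
have [/existsP[c1 hc1]|/existsPn light] := boolP [exists c, heavy c]; last first.
  by exists x0 => S t _ _; apply: half.
(* A node of lowest rank whose subtree is heavy: a component is either inside a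
   light subtree below c, or disjoint from the subtree of c. *)
case: (arg_minnP rk hc1) => c hc cmin; exists c => S t SC cS.
have [x xt|no] := pickP (mem (comp S t)); last first.
  rewrite big1 // => z /andP[_ /andP[_ /orP[|/par_inP[y _]]]] => [zt|yt].
    by have := no z; rewrite /= zt.
  by have := no y; rewrite /= yt.
have tS : t \in S.
  by move: xt; rewrite /= inE => /andP[xS /eqP<-]; apply: top_in.
have [tc|tc] := boolP (t \in desc c).
  apply: half; apply/negP => /cmin; rewrite leqNgt (desc_rk tc) //.
  by apply: contraNneq cS => <-.
have out z : z \in comp S t -> z \in desc c -> False.
  rewrite inE => /andP[zS /eqP zt] zc; move/negP: tc; apply.
  by rewrite -zt; apply: top_desc.
have split_sum : \sum_(z in C) w z = \sum_(z in C :&: desc c) w z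
    + \sum_(z in C | z \notin desc c) w z.
  rewrite (bigID (mem (desc c))) /=; congr (_ + _).
  by apply: eq_bigl => z; rewrite in_setI.
have: \sum_(z in C | (z != c) && ((z \in comp S t) || par_in (comp S t) z)) w z
    <= \sum_(z in C | z \notin desc c) w z.
  rewrite [leqLHS]big_mkcondr [leqRHS]big_mkcondr /=; apply: leq_sum => z _.
  case: (boolP (z \in desc c)) => zc /=; last by case: ifP.
  case: (eqVneq z c) => //= zc'; case: ifP => // /orP[/out/(_ zc)//|/par_inP[y zy] /out].
  by move/(_ (desc_up zc zc' zy)).
move: hc; rewrite /heavy split_sum.
by set a := bigop _ _ _; set b := bigop _ _ _; set d := bigop _ _ _; lia.
Qed.

(* C need not be connected; the whole node set is a piece. *)
Definition piece (C : {set V}) : Prop :=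
  #|[set x in C | par_in (~: C) x]| <= 1 /\ #|[set z in ~: C | par_in C z]| <= 4.

(** [B] gathers at most 1 node with its parent outside, at most 4 with a child outside, and two
    centroids, for size and for attachments; hence 7. *)
Lemma piece_split (C : {set V}) : piece C -> C != set0 ->
  exists B : {set V}, [/\ B \subset C, #|B| <= 7,
    forall x y, par x = Some y -> x \in C -> y \notin C -> x \in B,
    forall x y, par x = Some y -> x \notin C -> y \in C -> y \in B &
    forall t, let K := comp (C :\: B) t in piece K /\ 2 * #|K| <= #|C|].
Proof.
case=> [hU hD] /set0Pn[x0 _].
set U := [set _ in _ | _] in hU; set D := [set _ in _ | _] in hD.
(* c2 halves the at most 4 attachments of C, and c1 and c2 add at most 2 new
   ones, which restores the bound 4. *)
pose w z := \sum_(d in D) (par d == Some z : nat).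
have [c1 hc1] := centroid C (fun=> 1) x0.
have [c2 hc2] := centroid C w x0.
pose PD := [set odflt d (par d) | d in D].
have wC : \sum_(z in C) w z <= #|D|.
  rewrite /w exchange_big /= -sum1_card; apply: leq_sum => d dD.
  move: (dD); rewrite inE => /andP[_ /par_inP[y dy yC]].
  rewrite (bigD1 y) //= big1 ?addn0; last first.
    by move=> z /andP[_ zy]; rewrite dy; case: eqP => // -[E]; rewrite E eqxx in zy.
  by case: eqP.
pose B := C :&: (U :|: PD :|: [set c1; c2]).
have SC : C :\: B \subset C by apply: subsetDl.
have c1S : c1 \notin C :\: B by rewrite !inE eqxx !orbT andbT andNb.
have c2S : c2 \notin C :\: B by rewrite !inE eqxx !orbT andbT andNb.
have PB x y : par x = Some y -> x \notin C -> y \in C -> y \in B.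
  move=> xy xC yC; rewrite in_setI yC !in_setU orbAC; apply/orP; right.
  by apply/imsetP; exists x; rewrite ?xy // !inE xC; apply/par_inP; exists y.
exists B; split=> //.
- exact: subsetIl.
- apply: leq_trans (subset_leq_card (subsetIr _ _)) _.
  apply: leq_trans (leq_card_setU _ _) _; apply: (@leq_add _ _ 5 2); last by rewrite cards2; case: eqP.
  apply: leq_trans (leq_card_setU _ _) _; apply: (@leq_add _ _ 1 4) => //.
  by apply: leq_trans (leq_imset_card _ _) _.
- move=> x y xy xC yC; rewrite !inE xC /=; apply/orP; left; apply/orP; left.
  by apply/par_inP; exists y; rewrite ?inE.
move=> t K; split; last first.
  apply: leq_trans (leq_trans (hc1 (C :\: B) t SC c1S) _); last by rewrite sum1_card.
  rewrite sum1_card leq_mul2l /=; apply: subset_leq_card; apply/subsetP => z zK.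
  rewrite unfold_in /= -/K zK andbT; move: (zK); rewrite inE => /andP[zS _].
  by rewrite (subsetP SC _ zS) /=; apply: contraNneq c1S => <-.
split.
  (* Only the root [t] can have its parent outside [K]: a parent in [C :\: B] has the same top. *)
  rewrite -(cards1 t); apply: subset_leq_card; apply/subsetP => x.
  rewrite in_set => /andP[xK /par_inP[y xy yK]].
  have /andP[xS /eqP xt] : (x \in C :\: B) && (top (C :\: B) x == t) by move: xK; rewrite in_set.
  have [yS|yS] := boolP (y \in C :\: B); last by rewrite -xt (top_exit xy yS) in_set1.
  by move: yK; rewrite in_setC in_set yS -(top_par xy yS) xt eqxx.
set E := [set _ in _ | _].
(* A node outside [K] with its parent in [K] lies in [B]. As that parent is in [C], the node is a
   centroid or the parent of an old attachment, so of positive weight. *)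
have sub : E \subset [set c1; c2] :|:
    [set z in C | [&& (z != c2), (z \in K) || par_in K z & 0 < w z]].
  apply/subsetP => z; rewrite /E in_set in_setC => /andP[zK zpar].
  rewrite in_setU in_set2 in_set zpar orbT /=.
  have [->|z1] := eqVneq z c1 => //; have [->|z2] := eqVneq z c2 => //=.
  move/par_inP: (zpar) => [y zy yK].
  have /andP[yS _] : (y \in C :\: B) && (top (C :\: B) y == t) by move: yK; rewrite inE.
  have yC := subsetP SC _ yS.
  have yB : y \notin B by move: yS; rewrite in_setD => /andP[].
  have zC : z \in C by apply: contraNT yB => zC; exact: PB zy zC yC.
  rewrite zC /=.
  have zB : z \in B.
    apply: contraNT zK => zB.
    have zS : z \in C :\: B by rewrite in_setD zB.
    by rewrite in_set zS (top_par zy yS); move: yK; rewrite in_set yS.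
  move: zB; rewrite in_setI zC !in_setU !in_set1 (negPf z1) (negPf z2) !orbF /=.
  case/orP.
    rewrite in_set => /andP[_ /par_inP[y1]]; rewrite zy => -[<-].
    by rewrite in_setC yC.
  case/imsetP => d dD ->; move: (dD); rewrite inE => /andP[_ /par_inP[v dv _]].
  by rewrite dv /= /w (bigD1 d) //= dv eqxx.
apply: leq_trans (subset_leq_card sub) _.
apply: leq_trans (leq_card_setU _ _) _; apply: (@leq_add _ _ 2 2); first by rewrite cards2; case: eqP.
have := leq_trans (hc2 (C :\: B) t SC c2S) (leq_trans wC hD).
rewrite -(@leq_pmul2l 2 _ 2) //; apply: leq_trans; rewrite leq_mul2l /=.
rewrite -sum1_card (eq_bigl (fun z => (z \in C) &&
  ((z != c2) && ((z \in K) || par_in K z)) && (0 < w z))); last first.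
  by move=> z; rewrite inE !andbA.
rewrite big_mkcondr; apply: leq_sum => z _; by case: (w z).
Qed.

End Rooted.

(** * Intervals *)

(* The slack is about 3 log i; spreading the three logarithms makes it grow by at
   most 1 at each step, so that [rounding] is monotone. *)
Definition slack (i : nat) : nat :=
  trunc_log 2 (i + 3) + trunc_log 2 (i + 4) + trunc_log 2 (i + 5).
Definition rounding (i : nat) : nat := i - slack i.
Definition grain (i : nat) : nat := 2 ^ rounding i.

Lemma grain_gt0 i : 0 < grain i.
Proof. by rewrite expn_gt0. Qed.

Lemma trunc_log2_bounds n : 0 < n -> 2 ^ trunc_log 2 n <= n < 2 * 2 ^ trunc_log 2 n.
Proof. by move=> n0; rewrite -expnS; apply: trunc_log_bounds. Qed.

(** Consecutive slacks share two logarithms, and the third grows by at most 1 since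
    [i + 6 <= 2 * (i + 3)]. *)
Lemma slackS i : slack i.+1 <= (slack i).+1.
Proof.
have: trunc_log 2 (i + 6) <= (trunc_log 2 (i + 3)).+1.
  rewrite -ltnS -(ltn_exp2l _ _ (ltnSn 1)).
  have /andP[h _] := @trunc_log2_bounds (i + 6) ltac:(lia).
  have /andP[_ h'] := @trunc_log2_bounds (i + 3) ltac:(lia).
  by apply: leq_ltn_trans h _; rewrite !expnS; lia.
by rewrite /slack !addSnnS; lia.
Qed.

Lemma rounding_mono i j : i <= j -> rounding i <= rounding j.
Proof.
move/subnK <-; elim: (j - i) => // d IH; apply: leq_trans IH _; rewrite addSn /rounding.
have := slackS (d + i); lia.
Qed.

Lemma grain_dvd i j : i <= j -> grain i %| grain j.
Proof. by move/rounding_mono; apply: dvdn_exp2l. Qed.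

Lemma exp2_cubic i : i * i.+1 ^ 2 <= 8 * 2 ^ i.
Proof.
have [|i4] := ltnP i 4; first by do 4 (case: i => [//|i]).
rewrite -(subnK i4); elim: (i - 4) => [//|d IH]; rewrite addSn (expnS 2).
apply: leq_trans (_ : 2 * ((d + 4) * (d + 4).+1 ^ 2) <= _); last by rewrite [leqRHS]mulnCA leq_mul2l.
set x := d + 4; have: 4 <= x by rewrite leq_addl.
by rewrite !expnS expn0; nia.
Qed.

(** The logarithms make [2 ^ slack i] at least [(i + 3) * (i + 4) * (i + 5) / 8]. For positive [i],
    a waste of [i + 1] grains is thus at most [2 ^ i] times the telescoping [8 / (i * (i + 1))]. *)
Lemma grain_bound i : grain i * (i * i.+1 ^ 2) <= 8 * 2 ^ i.
Proof.
have [hi|hi] := leqP (slack i) i; last first.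
  by rewrite /grain /rounding (eqP (ltnW hi)) mul1n exp2_cubic.
have -> : 2 ^ i = grain i * 2 ^ slack i by rewrite -expnD /rounding subnK.
rewrite [leqRHS]mulnCA leq_mul2l; apply/orP; right; rewrite /slack !expnD.
have /andP[_ h3] := @trunc_log2_bounds (i + 3) ltac:(lia).
have /andP[_ h4] := @trunc_log2_bounds (i + 4) ltac:(lia).
have /andP[_ h5] := @trunc_log2_bounds (i + 5) ltac:(lia).
apply: leq_trans (_ : (2 * 2 ^ trunc_log 2 (i + 3)) * (2 * 2 ^ trunc_log 2 (i + 4)) *
  (2 * 2 ^ trunc_log 2 (i + 5)) <= _); last by lia.
apply: leq_trans (_ : (i + 3) * (i + 4) * (i + 5) <= _); first by rewrite expnS expn1; nia.
by rewrite !leq_mul // ltnW.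
Qed.

Lemma exp2_grain i : 2 ^ i <= grain i * 2 ^ slack i.
Proof. by rewrite -expnD leq_exp2l // /rounding; lia. Qed.

(** * Packing the intervals of the children *)

Section Packing.
Variables (T : finType) (P : pred T) (kind len : T -> nat) (i : nat).
Hypothesis kind_lt : forall t, P t -> kind t < i.
Hypothesis len_dvd : forall t, P t -> grain (kind t) %| len t.

Definition load (j : nat) : nat := \sum_(t | P t && (kind t == j)) len t.
(* In grains; the leading 1 reserves the first grain for the bag itself. *)
Definition block (j : nat) : nat := 1 + \sum_(l < j) (load l %/ grain i).+1.
Definition offset (t : T) : nat := block (kind t) * grain i +
  \sum_(s | P s && (kind s == kind t) && (enum_rank s < enum_rank t)) len s.

Lemma blockS j : block j.+1 = block j + (load j %/ grain i).+1.
Proof. by rewrite /block big_ord_recr addnA. Qed.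

Lemma block_mono j k : j <= k -> block j <= block k.
Proof.
move/subnK <-; elim: (k - j) => // d IH; apply: leq_trans IH _.
by rewrite addSn blockS leq_addr.
Qed.

(** Rounding wastes at most one grain per class, and the bag takes one more. *)
Lemma block_total : block i * grain i <= grain i * i.+1 + \sum_(t | P t) len t.
Proof.
have -> : \sum_(t | P t) len t = \sum_(j < i) load j.
  rewrite /load (exchange_big_dep P) /=; last by move=> j t _ /andP[].
  apply: eq_bigr => t Pt; rewrite (big_pred1 (Ordinal (kind_lt Pt))) // => j.
  by rewrite Pt /= -val_eqE eq_sym.
rewrite /block mulnDl mul1n big_distrl /= mulnS -addnA leq_add2l.
rewrite [X in X + _](_ : _ = \sum_(j < i) grain i); last by rewrite sum_nat_const card_ord mulnC.
by rewrite -big_split /=; apply: leq_sum => j _; rewrite mulSn leq_add2l leq_divM.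
Qed.

(** Blocks start at multiples of the coarser [grain i], and the preceding siblings in the block have
    the same kind as [t]. *)
Lemma offset_dvd t : P t -> grain (kind t) %| offset t.
Proof.
move=> Pt; apply: dvdn_add; first by apply/dvdn_mull/grain_dvd/ltnW; apply: kind_lt.
by apply: dvdn_sum => s /andP[/andP[Ps /eqP<-] _]; apply: len_dvd.
Qed.

Lemma offset_ge t : block (kind t) * grain i <= offset t.
Proof. exact: leq_addr. Qed.

Lemma offset_next s t : P s -> kind s = kind t -> enum_rank s < enum_rank t ->
  offset s + len s <= offset t.
Proof.
move=> Ps st rst; rewrite /offset st -addnA leq_add2l.
rewrite [leqRHS](bigD1 s) /=; last by rewrite Ps st eqxx.
rewrite addnC leq_add2l [leqLHS]big_mkcond [leqRHS]big_mkcond; apply: leq_sum => q _ /=.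
case: (P q && (kind q == kind t)) => //=; case: (boolP (_ < enum_rank s)) => //= qs.
rewrite (ltn_trans qs rst) /=; case: eqP => // E; by rewrite E ltnn in qs.
Qed.

Lemma offset_lt t : P t -> offset t + len t <= block (kind t).+1 * grain i.
Proof.
move=> Pt; apply: leq_trans (_ : block (kind t) * grain i + load (kind t) <= _).
  rewrite /offset -addnA leq_add2l /load [leqRHS](bigD1 t) /=; last by rewrite Pt eqxx.
  rewrite addnC leq_add2l [leqLHS]big_mkcond [leqRHS]big_mkcond; apply: leq_sum => q _ /=.
  by case: (P q && (kind q == kind t)) => //=; case: eqP => [->|_]; rewrite ?ltnn //=; case: ifP.
rewrite blockS mulnDl leq_add2l; apply: ltnW.
exact: ltn_ceil (grain_gt0 i).
Qed.

Lemma offset_disjoint s t : P s -> P t -> s != t ->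
  offset s + len s <= offset t \/ offset t + len t <= offset s.
Proof.
move=> Ps Pt st; have [lt|lt|e] := ltngtP (kind s) (kind t).
- left; apply: leq_trans (offset_lt Ps) (leq_trans _ (offset_ge t)).
  by rewrite leq_mul2r block_mono // orbT.
- right; apply: leq_trans (offset_lt Pt) (leq_trans _ (offset_ge s)).
  by rewrite leq_mul2r block_mono // orbT.
- have [lt|lt|/val_inj/enum_rank_inj E] := ltngtP (enum_rank s) (enum_rank t).
  + by left; apply: offset_next.
  + by right; apply: offset_next.
  + by rewrite E eqxx in st.
Qed.

End Packing.

(** * Layouts of pieces *)

Definition width (i : nat) : nat := slack i + 5.

Section Layout.
Variables (V : finType) (par : V -> option V) (rk : V -> nat).
Hypothesis rk_par : forall x y, par x = Some y -> rk x < rk y.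

(* The bag of x is identified by the pair (cls x, pos x), and [pnode x] is the
   pair of its parent bag; [tab y j] is the start of the j-th block of the bag of
   y, in grains from [pos y]. *)
Record layout := Layout {
  len : nat;
  cls : V -> nat;
  pos : V -> nat;
  tab : V -> nat -> nat;
  pnode : V -> option (nat * nat);
  idx : V -> nat }.

Definition in_block (d : layout) (y x : V) : bool :=
  pos d y + tab d y (cls d x) * grain (cls d y) <= pos d x
    < pos d y + tab d y (cls d x).+1 * grain (cls d y).

Definition fadj (x y : V) : bool := (par x == Some y) || (par y == Some x).

(** [valid_boundary] lets the recursion attach a piece to its parent bag through its root bag alone.
    The class identifies the root bag because classes strictly decrease down the tree. *)
Record valid (C : {set V}) (d : layout) : Prop := Valid {
  (* len <= (9 - 8 / (class + 1)) |C|: the increasing factor absorbs the rounding *)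
  valid_len : len d * (trunc_log 2 #|C|).+1 + 8 * #|C| <= 9 * (trunc_log 2 #|C|).+1 * #|C|;
  valid_dvd : grain (trunc_log 2 #|C|) %| len d;
  valid_cls x : x \in C -> cls d x <= trunc_log 2 #|C|;
  valid_pos_dvd x : x \in C -> grain (cls d x) %| pos d x;
  valid_pos_lt x : x \in C -> pos d x < len d;
  valid_idx x : x \in C -> idx d x < 7;
  valid_inj x y : x \in C -> y \in C -> cls d x = cls d y -> pos d x = pos d y ->
    idx d x = idx d y -> x = y;
  valid_root x : x \in C -> (pnode d x = None <-> cls d x = trunc_log 2 #|C|);
  valid_root_pos x : x \in C -> cls d x = trunc_log 2 #|C| -> pos d x = 0;
  valid_boundary x y : x \in C -> y \notin C -> fadj x y -> cls d x = trunc_log 2 #|C|;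
  valid_edge x y : x \in C -> y \in C -> fadj x y ->
    [\/ cls d x = cls d y /\ pos d x = pos d y, pnode d x = Some (cls d y, pos d y) |
        pnode d y = Some (cls d x, pos d x)];
  valid_pnode x c p : x \in C -> pnode d x = Some (c, p) ->
    [/\ c <= trunc_log 2 #|C|, grain c %| p & p <= pos d x < p + grain c * 2 ^ width c];
  valid_tab y j : y \in C -> 0 < tab d y j < 2 ^ width (cls d y) /\
    pos d y + tab d y j * grain (cls d y) <= len d;
  valid_block x y : x \in C -> y \in C ->
    (pnode d x = Some (cls d y, pos d y) <-> in_block d y x) }.

Lemma trunc_log2_half m n : 0 < m -> 2 * m <= n -> trunc_log 2 m < trunc_log 2 n.
Proof.
move=> m0 mn; have n0 : 0 < n by lia.
rewrite -ltnS -(ltn_exp2l _ _ (ltnSn 1)).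
have /andP[h _] := trunc_log2_bounds m0; have /andP[_ h'] := trunc_log2_bounds n0.
by apply: leq_ltn_trans (_ : n < _); rewrite ?expnS; lia.
Qed.

(** * Gluing the layouts of the components *)

Section Glue.
Variables (C B : {set V}) (D : V -> layout).
Local Notation tp := (top par rk (C :\: B)).
Local Notation K := (comp par rk (C :\: B)).
Local Notation P := (fun t => K t != set0).
Local Notation kd := (fun t => trunc_log 2 #|K t|).
Local Notation ln := (fun t => len (D t)).
Local Notation i := (trunc_log 2 #|C|).
Local Notation off := (offset P kd ln i).
Local Notation blk := (block P kd ln i).

Hypothesis C0 : C != set0.
Hypothesis B7 : #|B| <= 7.
Hypothesis B_bound : forall x y, fadj x y -> x \in C -> y \notin C -> x \in B.
Hypothesis half : forall t, 2 * #|K t| <= #|C|.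
Hypothesis DP : forall t, K t != set0 -> valid (K t) (D t).

(** The root bags of the components, so far without parent, get [(i, 0)]. The cap [minn j i] serves
    [valid_tab], which bounds the entry at every [j]. *)
Definition glue : layout := {|
  len := blk i * grain i;
  cls := fun x => if x \in B then i else cls (D (tp x)) x;
  pos := fun x => if x \in B then 0 else off (tp x) + pos (D (tp x)) x;
  tab := fun x => if x \in B then fun j => blk (minn j i) else tab (D (tp x)) x;
  pnode := fun x => if x \in B then None else
    if pnode (D (tp x)) x is Some (c, p) then Some (c, off (tp x) + p) else Some (i, 0);
  idx := fun x => if x \in B then index x (enum B) else idx (D (tp x)) x |}.

Lemma kind_lt t : P t -> kd t < i.
Proof. by move=> Pt; apply: trunc_log2_half (half t); rewrite card_gt0. Qed.

Lemma len_dvd t : P t -> grain (kd t) %| ln t.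
Proof. by move=> Pt; apply: valid_dvd (DP Pt). Qed.

Variant glue_spec (x : V) : bool -> Prop :=
| GlueBag of x \in B : glue_spec x true
| GlueComp t of x \in K t & tp x = t & P t & valid (K t) (D t) : glue_spec x false.

Lemma glueP x : x \in C -> glue_spec x (x \in B).
Proof.
move=> xC; case: (boolP (x \in B)) => xB; first exact: GlueBag.
have xK : x \in K (tp x) by rewrite in_set in_setD xB xC eqxx.
have Px : P (tp x) by apply/set0Pn; exists x.
by apply: (@GlueComp _ (tp x)) => //; apply: DP.
Qed.

Lemma off_gt0 t : 0 < off t.
Proof.
by apply: leq_trans (offset_ge P kd ln i t); rewrite muln_gt0 grain_gt0.
Qed.

Lemma off_len t : P t -> off t + ln t <= blk i * grain i.
Proof.
move=> Pt; apply: leq_trans (@offset_lt _ P kd ln i t Pt) _.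
by rewrite leq_mul2r block_mono ?orbT // kind_lt.
Qed.

Lemma off_apart s t a b : P s -> P t -> s != t -> a < ln s -> b < ln t ->
  off s + a <> off t + b.
Proof.
move=> Ps Pt st ha hb; have := @offset_disjoint _ P kd ln i s t Ps Pt st. lia.
Qed.

Lemma card_gt : 0 < #|C|.
Proof. by rewrite card_gt0. Qed.

(** For positive [i], the components have classes below [i] and total length at most
    [(9 - 8 / i) * #|C|]. By [grain_bound] the waste is at most [(8 / i - 8 / (i + 1)) * #|C|]. *)
Lemma glue_len : blk i * grain i * i.+1 + 8 * #|C| <= 9 * i.+1 * #|C|.
Proof.
have tot : blk i * grain i <= grain i * i.+1 + \sum_(t | P t) ln t by apply: block_total kind_lt.
have cnt : \sum_(t | P t) #|K t| <= #|C|.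
  apply: leq_trans (_ : \sum_t \sum_(x in C :\: B) (tp x == t : nat) <= _).
    rewrite big_mkcond; apply: leq_sum => t _; case: ifP => // _.
    rewrite -sum1_card [leqRHS]big_mkcond [leqLHS]big_mkcond; apply: leq_sum => x _ /=.
    by rewrite in_set; case: (x \in C :\: B) => //=; case: eqP.
  rewrite exchange_big /=; apply: leq_trans (subset_leq_card (subsetDl C B)).
  rewrite -sum1_card; apply: leq_sum => x _; rewrite (bigD1 (tp x)) //= eqxx big1 // => t.
  by rewrite eq_sym => /negPf->.
have sml : (\sum_(t | P t) ln t) * i + 8 * (\sum_(t | P t) #|K t|) <= 9 * i * (\sum_(t | P t) #|K t|).
  rewrite big_distrl !big_distrr /= -big_split /=; apply: leq_sum => t Pt.
  have := valid_len (DP Pt); have := kind_lt Pt.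
  by move: (trunc_log 2 #|K t|) (trunc_log 2 #|C|) #|K t| (len _) => k l m n; nia.
have gb := grain_bound i.
have /andP[ci _] := trunc_log2_bounds card_gt.
move: tot cnt sml gb ci card_gt.
(* In class 0 there are no components, only the grain of the bag. *)
have z0 : i = 0 -> \sum_(t | P t) ln t = 0.
  by move=> i0; apply: big1 => t /kind_lt; rewrite i0.
move: z0; move: (blk i * grain i) => A; move: (\sum_(t | P t) ln t) (\sum_(t | P t) #|K t|) #|C|.
move=> L M N; move: (trunc_log 2 N) => j z0 tot cnt sml gb ci N0.
case: j z0 tot sml gb ci => [|j] z0 tot sml gb ci.
  by rewrite z0 // /grain /rounding sub0n expn0 in tot; lia.
rewrite -(@leq_pmul2l j.+1) //.
have h1 : A * (j.+1 * j.+2) <= 8 * N + L * (j.+1 * j.+2).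
  apply: leq_trans (_ : (grain j.+1 * j.+2 + L) * (j.+1 * j.+2) <= _); first by rewrite leq_mul2r tot orbT.
  rewrite mulnDl leq_add2r; apply: leq_trans (_ : 8 * 2 ^ j.+1 <= _); last by lia.
  by apply: leq_trans gb; rewrite -!mulnA leq_mul2l; apply/orP; right; rewrite expnS expn1; lia.
have h2 : (L * j.+1 + 8 * M) * j.+2 <= 9 * j.+1 * M * j.+2 by rewrite leq_mul2r sml orbT.
have h3 : (9 * j + 1) * M * j.+2 <= (9 * j + 1) * N * j.+2 by rewrite !leq_mul.
nia.
Qed.

(** The length is at most [9 * #|C| < 18 * 2 ^ i], below [2 ^ 5 * 2 ^ i]; hence the 5 in [width]. *)
Lemma blk_width j : blk (minn j i) < 2 ^ width i.
Proof.
apply: leq_ltn_trans (block_mono P kd ln i (geq_minr j i)) _.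
rewrite -(ltn_pmul2r (grain_gt0 i)).
have h : blk i * grain i <= 9 * #|C|.
  have := glue_len; set A := _ * grain i; move: (trunc_log 2 _) => l; nia.
apply: leq_ltn_trans h _; have /andP[_ ci] := trunc_log2_bounds card_gt.
have := exp2_grain i; rewrite /width expnD; nia.
Qed.

Lemma glue_valid : valid C glue.
Proof.
split=> /=.
- exact: glue_len.
- exact: dvdn_mull.
- move=> x /glueP[//|t xt -> Pt vt].
  by apply: leq_trans (valid_cls vt xt) (ltnW (kind_lt Pt)).
- move=> x /glueP[_|t xt -> Pt vt]; first exact: dvdn0.
  apply: dvdn_add (valid_pos_dvd vt xt).
  exact: dvdn_trans (grain_dvd (valid_cls vt xt)) (@offset_dvd _ P kd ln i kind_lt len_dvd t Pt).
- move=> x /glueP[_|t xt -> Pt vt]; first by rewrite muln_gt0 grain_gt0.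
  by apply: leq_trans (off_len Pt); rewrite ltn_add2l; apply: valid_pos_lt xt.
- move=> x /glueP[xB|t xt -> Pt vt]; last exact: valid_idx xt.
  by apply: leq_trans B7; rewrite cardE index_mem mem_enum.
- move=> x y /glueP[xB|t xt -> Pt vt] /glueP[yB|s ys -> Ps vs].
  + by move=> _ _; apply: index_inj; rewrite ?mem_enum.
  + by move=> E; have := valid_cls vs ys; rewrite -E leqNgt kind_lt.
  + by move=> E; have := valid_cls vt xt; rewrite E leqNgt kind_lt.
  + have [ts|ts] := eqVneq t s; last first.
      by move=> _ /(off_apart Pt Ps ts (valid_pos_lt vt xt) (valid_pos_lt vs ys)).
    by move: ys; rewrite -ts => ys E1 /addnI E2; apply: (valid_inj vt xt ys E1 E2).
- move=> x /glueP[//|t xt -> Pt vt]; split.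
    by case: pnode => // -[].
  by move=> E; have := valid_cls vt xt; rewrite E leqNgt kind_lt.
- move=> x /glueP[//|t xt -> Pt vt].
  by move=> E; have := valid_cls vt xt; rewrite E leqNgt kind_lt.
- by move=> x y xC yC xy; rewrite (B_bound xy xC yC).
(* An edge between the bag and a component ends on the boundary of the component, hence in its root
   bag. *)
- have cross x y t : x \in B -> y \in K t -> P t -> valid (K t) (D t) -> fadj x y ->
      pnode (D t) y = None.
    move=> xB yt Pt vt xy; apply/(valid_root vt yt); apply: (valid_boundary vt yt) (_ : x \notin _) _.
      by rewrite in_set in_setD xB.
    by rewrite /fadj orbC.
  move=> x y /glueP[xB|t xt tx Pt vt] /glueP[yB|s ys sy Ps vs] xy.
  + by constructor 1.
  + by rewrite sy (cross x y s xB) //; constructor 3.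
  + by rewrite tx (cross y x t yB) // 1?/fadj 1?orbC //; constructor 2.
  + rewrite tx sy; have ts : t = s.
      have yS : y \in C :\: B by move: ys; rewrite in_set => /andP[].
      have xS : x \in C :\: B by move: xt; rewrite in_set => /andP[].
      by rewrite -tx -sy; case/orP: xy => /eqP xy;
        [rewrite (top_par rk_par xy)|rewrite (top_par rk_par xy)].
    subst s; rewrite -ts in ys vs *.
    by case: (valid_edge vt xt ys xy) => [[-> ->]|->|->];
      [constructor 1|constructor 2|constructor 3].
- move=> x c p /glueP[//|t xt -> Pt vt].
  have plt := valid_pos_lt vt xt.
  case E: pnode => [[c' p']|] [<- <-].
    have [h1 h2 /andP[h3 h4]] := valid_pnode vt xt E; split.
    - exact: leq_trans h1 (ltnW (kind_lt Pt)).
    - apply: dvdn_add h2; apply: dvdn_trans (grain_dvd h1) _.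
      exact: (@offset_dvd _ P kd ln i kind_lt len_dvd t Pt).
    - by rewrite leq_add2l h3 -addnA ltn_add2l.
  split=> //; rewrite add0n mulnC; apply: leq_trans (_ : blk (minn i i) * grain i <= _).
    by rewrite minnn; apply: leq_trans (off_len Pt); rewrite ltn_add2l.
  by rewrite leq_mul2r ltnW ?orbT // blk_width.
- move=> y j /glueP[_|t yt -> Pt vt].
    split; first by rewrite blk_width.
    by rewrite add0n leq_mul2r block_mono ?orbT // geq_minr.
  have [h1 h2] := valid_tab vt j yt; split=> //.
  by rewrite -addnA; apply: leq_trans (off_len Pt); rewrite leq_add2l.
- move=> x y xC yC; rewrite /in_block /=.
  case/glueP: xC => [xB|t xt tx Pt vt]; case/glueP: yC => [yB|s ys sy Ps vs].
  + by split=> // /andP[]; rewrite add0n leqn0 muln_eq0 (gtn_eqF (grain_gt0 _)) orbF.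
  + by split=> //; rewrite sy; have := off_gt0 s; lia.
  (* The root bag of [K t] lies in the block of its class [kd t]. A deeper bag has smaller class,
     but lies past the end of the block of that class. *)
  + have lti : cls (D t) x < i := leq_ltn_trans (valid_cls vt xt) (kind_lt Pt).
    rewrite tx !add0n (minn_idPl (ltnW lti)) (minn_idPl lti).
    have lo := offset_ge P kd ln i t; have hi := @offset_lt _ P kd ln i t Pt.
    have plt := valid_pos_lt vt xt; have clt := valid_cls vt xt.
    case E: (pnode (D t) x) => [[c p]|].
      split; first by case=> _; have := off_gt0 t; lia.
      case/andP=> _ h; exfalso.
      have ck : cls (D t) x < kd t.
        rewrite ltn_neqAle clt andbT; apply/eqP => /(valid_root vt xt); by rewrite E.
      have := leq_mul (block_mono P kd ln i ck) (leqnn (grain i)); lia.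
    move/(valid_root vt xt): E => E; split=> // _; rewrite E; lia.
  (* Tables in [K s] point only into the interval of [K s], which is disjoint from those of the
     other components. *)
  + rewrite tx sy; have plt := valid_pos_lt vt xt.
    have [ts|ts] := eqVneq t s; last first.
      split=> [|/andP[h1 h2]]; last first.
        have [_ h] := valid_tab vs (cls (D t) x).+1 ys.
        exfalso; apply: (off_apart Pt Ps ts plt
          (_ : off t + pos (D t) x - off s < _)); lia.
      case E: (pnode (D t) x) => [[c p]|] [].
        move=> _ h; have [_ _ /andP[hp _]] := valid_pnode vt xt E.
        by case: (off_apart Pt Ps ts (leq_ltn_trans hp plt) (valid_pos_lt vs ys) h).
      by move=> E'; have := valid_cls vs ys; rewrite -E' leqNgt kind_lt.
    subst s; rewrite -ts in ys vs *.
    move: (off t) => o; rewrite -!addnA leq_add2l ltn_add2l.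
    have := valid_block vt xt ys; rewrite /in_block; case: (pnode (D t) x) => [[c p]|] H.
      split=> [[Ec Ep]|/H[-> ->] //]; apply/H; rewrite Ec; congr (Some (_, _)); lia.
    by split=> [[E']|/H//]; have := valid_cls vt ys; rewrite -E' leqNgt kind_lt.
Qed.
End Glue.

Lemma layout_exists (C : {set V}) : piece par C -> C != set0 -> exists d, valid C d.
Proof.
move: {2}#|C| (leqnn #|C|) => m; elim: m C => [|m IH] C Cm pC C0.
  by move: C0; rewrite -cards_eq0; move: Cm; rewrite leqn0 => ->.
have [B [_ B7 up_B down_B pK]] := piece_split rk_par pC C0.
pose K := comp par rk (C :\: B).
have /fin_all_exists[D DP] t : exists d, K t != set0 -> valid (K t) d.
  have [E|K0] := eqVneq (K t) set0.
    by exists (Layout 0 (fun=> 0) (fun=> 0) (fun _ _ => 0) (fun=> None) (fun=> 0)).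
  have [pKt hKt] := pK t; have [|d vd] := IH _ _ pKt K0; last by exists d.
  have := K0; rewrite -card_gt0 -/(K t) in hKt *; lia.
exists (glue C B D); apply: glue_valid => // [x y /orP[]/eqP xy xC yC|t].
- exact: up_B xy xC yC.
- exact: down_B xy yC xC.
- by case: (pK t).
Qed.
End Layout.

(** * Labels *)

Lemma square_le_exp2 c : exists K, forall y, c * y ^ 2 <= 2 ^ y + K.
Proof.
have cube y : y ^ 3 <= 8 * 2 ^ y.
  have [|y4] := ltnP y 4; first by do 4 (case: y => [//|y]).
  rewrite -(subnK y4); elim: (y - 4) => [//|d IH]; rewrite addSn (expnS 2).
  apply: leq_trans (_ : 2 * (d + 4) ^ 3 <= _); last by rewrite [leqRHS]mulnCA leq_mul2l.
  by rewrite !expnS !expn0; nia.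
(* Beyond [8 * c], [8 * c * y ^ 2 <= y ^ 3 <= 8 * 2 ^ y]; the constant covers smaller [y]. *)
exists (c * (8 * c) ^ 2) => y; have [yc|cy] := leqP y (8 * c).
  by apply: leq_trans (leq_addl _ _); rewrite leq_mul2l leq_exp2r // yc orbT.
apply: leq_trans (leq_addr _ _); rewrite -(@leq_pmul2l 8) // mulnA.
by apply: leq_trans (cube y); rewrite expnS leq_mul2r (ltnW cy) orbT.
Qed.

Lemma trunc_log2_le n m : n < 2 * 2 ^ m -> trunc_log 2 n <= m.
Proof.
move=> h; case: n h => [|n] h; first by rewrite trunc_log0.
have /andP[h1 _] := @trunc_log2_bounds n.+1 isT.
by rewrite -ltnS -(ltn_exp2l _ _ (ltnSn 1)) expnS; apply: leq_ltn_trans h1 h.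
Qed.

Lemma slack_le i m : i < 2 ^ m -> slack i <= 3 * m + 6.
Proof.
move=> h; have m4 : 1 <= 2 ^ m by rewrite expn_gt0.
have le k : k <= 5 -> trunc_log 2 (i + k) <= m + 2.
  by move=> k5; apply: trunc_log2_le; rewrite expnD; lia.
by have := (le 3 isT, le 4 isT, le 5 isT) => -[[]]; rewrite /slack; lia.
Qed.

(** The table serves only child classes [j] with [2 ^ (j %/ 16) <= i], so
    [j < 16 * (trunc_log 2 i).+1]; the last entry ends the last block. *)
Definition slots (i : nat) : nat := 16 * (trunc_log 2 i).+1 + 1.

Lemma slots_lt i j : 2 ^ (j %/ 16) <= i -> j.+1 < slots i.
Proof.
move=> h; have i0 : 0 < i by apply: leq_trans h; rewrite expn_gt0.
have /andP[_ h1] := trunc_log2_bounds i0.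
have : 2 ^ (j %/ 16) < 2 ^ (trunc_log 2 i).+1 by rewrite expnS; apply: leq_ltn_trans h1.
rewrite ltn_exp2l // /slots => h2; lia.
Qed.

Lemma table_bits_le : exists K, forall i, slack i + width i * slots i <= i %/ 4 + K.
Proof.
(* 300 bounds the quadratic in [m.+1] below; the factor 8 turns [2 ^ m.+1 <= 2 * i.+1] into a
   quarter of [i]. *)
have [K hK] := square_le_exp2 (8 * 300); exists K.+1 => i.
set m := trunc_log 2 i; have im : i < 2 ^ m.+1.
  rewrite /m; case: i {m} => [|i]; rewrite ?trunc_log0 // expnS.
  by case/andP: (@trunc_log2_bounds i.+1 isT).
have mi : 2 ^ m.+1 <= 2 * i.+1.
  rewrite /m expnS leq_mul2l /=; case: i {m im} => [|i]; rewrite ?trunc_log0 //.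
  by case/andP: (@trunc_log2_bounds i.+1 isT) => h _; apply: leqW.
have sl := slack_le im; have {hK} := hK m.+1.
rewrite /width /slots -/m.
have : slack i + (slack i + 5) * (16 * m.+1 + 1) <= 300 * m.+1 ^ 2.
  apply: leq_trans (_ : (3 * m.+1 + 6) + (3 * m.+1 + 6 + 5) * (16 * m.+1 + 1) <= _).
    by apply: leq_add => //; rewrite leq_mul2r leq_add2r sl orbT.
  by rewrite !expnS expn0; nia.
rewrite -mulnA; move: (300 * _) => a; move: (_ + _ * _) => b.
move: (2 ^ m.+1) mi => p; lia.
Qed.

(** Consecutive [i] pair up on one exponent, which leaves twice a geometric series. *)
Lemma sum_exp2_half L : \sum_(i < L.+1) 2 ^ (L - i %/ 2) <= 8 * 2 ^ L.
Proof.
have tele k : k <= L.+1 -> \sum_(i < 2 * k) 2 ^ (L.+1 - i %/ 2) + 4 * 2 ^ (L.+1 - k) = 4 * 2 ^ L.+1.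
  elim: k => [|k IH] kL; first by rewrite muln0 big_ord0 subn0.
  rewrite mulnS !addSn add0n !big_ord_recr /= -(IH (ltnW kL)).
  have -> : (2 * k) %/ 2 = k by lia.
  have -> : (2 * k).+1 %/ 2 = k by lia.
  have -> : L.+1 - k = (L.+1 - k.+1).+1 by lia.
  by rewrite expnS -!addnA; congr (_ + _); lia.
have := tele L.+1 (leqnn _); rewrite expnS => E.
apply: leq_trans (_ : \sum_(i < 2 * L.+1) 2 ^ (L.+1 - i %/ 2) <= _); last by lia.
rewrite (big_ord_widen (2 * L.+1) (fun i => 2 ^ (L - i %/ 2))); last by lia.
rewrite big_mkcond /=; apply: leq_sum => i _; case: ifP => // _.
by rewrite leq_exp2l //; lia.
Qed.

(** In order: position in grains, table, class and distance of a parent of small class, index in the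
    bag, two masks. Positions are below [2 ^ (L + 5)], and a class below [2 ^ (i %/ 16)] has width
    at most [3 * (i %/ 16) + 11]. *)
Definition label_data (L i : nat) : finType :=
  ('I_(2 ^ (L + 5 - rounding i)) * {ffun 'I_(slots i) -> 'I_(2 ^ width i)} *
   option ('I_(2 ^ (i %/ 16)) * 'I_(2 ^ (3 * (i %/ 16) + 11))) *
   'I_7 * {ffun 'I_7 -> bool} * {ffun 'I_7 -> bool})%type.

Definition label (L : nat) : finType := {i : 'I_L.+1 & label_data L i}.

(** The position of a class [i] label saves [i] bits up to the slack. Slack and table cost
    [i / 4 + O(1)] bits, the stored parent another [i / 4 + O(1)], which leaves [O(2 ^ (L - i / 2))]
    labels. *)
Lemma card_label : exists K, forall n, 0 < n -> #|label (trunc_log 2 n)| <= K * n.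
Proof.
(* 34 adds up 5 bits of the position, 12 of the stored parent, 3 of the index and 7 of each mask. *)
have [K0 hK0] := table_bits_le; pose K1 := K0 + 34.
exists (2 ^ K1 * 8) => n n0; set L := trunc_log 2 n.
have /andP[hL _] := trunc_log2_bounds n0.
rewrite card_tagged sumnE big_map big_enum /=.
apply: leq_trans (_ : 2 ^ K1 * \sum_(i < L.+1) 2 ^ (L - i %/ 2) <= _); last first.
  rewrite -mulnA leq_mul2l (leq_trans (sum_exp2_half L)) ?orbT //.
  by rewrite leq_mul2l.
rewrite big_distrr /=; apply: leq_sum => i _.
rewrite /label_data !card_prod !card_ffun card_option card_prod !card_ord card_bool.
rewrite -expnM -!expnD.
have o : (2 ^ (i %/ 16 + (3 * (i %/ 16) + 11))).+1 <= 2 ^ (4 * (i %/ 16) + 12).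
  by rewrite ltn_exp2l //; lia.
apply: leq_trans (_ : 2 ^ (L + 5 - rounding i + width i * slots i) * 2 ^ (4 * (i %/ 16) + 12)
   * 2 ^ 3 * 2 ^ 7 * 2 ^ 7 <= _).
  by do 4 (apply: leq_mul; last by []).
rewrite -!expnD leq_exp2l // /K1; have := hK0 i; have := ltn_ord i.
by rewrite /rounding; move: (slack i) (_ * slots i) => s w; lia.
Qed.

(* [lab_same] and [lab_up] give the neighbours of a node in its own bag and in the
   parent bag, by their indices there. *)
Section LabelGraph.
Variable L : nat.

Definition lab_cls (l : label L) : nat := tag l.
Definition lab_pos (l : label L) : nat := (tagged l).1.1.1.1.1 * grain (lab_cls l).
Definition lab_tab (l : label L) (j : nat) : nat :=
  oapp (fun o => val ((tagged l).1.1.1.1.2 o)) 0 (insub j).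
Definition lab_par (l : label L) : option (nat * nat) :=
  omap (fun co => (val co.1, val co.2)) (tagged l).1.1.1.2.
Definition lab_idx (l : label L) : 'I_7 := (tagged l).1.1.2.
Definition lab_same (l : label L) : {ffun 'I_7 -> bool} := (tagged l).1.2.
Definition lab_up (l : label L) : {ffun 'I_7 -> bool} := (tagged l).2.

Lemma label_encode (i q : nat) (t : nat -> nat) (pp : option (nat * nat)) (k : 'I_7)
    (s u : {ffun 'I_7 -> bool}) :
  i <= L -> q < 2 ^ (L + 5 - rounding i) -> (forall j, t j < 2 ^ width i) ->
  (forall c o, pp = Some (c, o) -> c < 2 ^ (i %/ 16) /\ o < 2 ^ (3 * (i %/ 16) + 11)) ->
  exists l, [/\ lab_cls l = i, lab_pos l = q * grain i,
    forall j, j < slots i -> lab_tab l j = t j & lab_par l = pp] /\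
    [/\ lab_idx l = k, lab_same l = s & lab_up l = u].
Proof.
rewrite -ltnS => iL hq ht hpp.
have [pp' hpp'] : exists pp' : option ('I_(2 ^ (i %/ 16)) * 'I_(2 ^ (3 * (i %/ 16) + 11))),
    omap (fun co => (val co.1, val co.2)) pp' = pp.
  case: pp hpp => [[c o]|] hpp; last by exists None.
  by have [hc ho] := hpp c o erefl; exists (Some (Ordinal hc, Ordinal ho)).
exists (@Tagged _ (Ordinal iL) (label_data L)
  (Ordinal hq, [ffun j : 'I_(slots i) => Ordinal (ht j)], pp', k, s, u)).
split; split=> // j js; rewrite /lab_tab /=.
by rewrite insubT /= ffunE.
Qed.

Definition same_node (l m : label L) : bool :=
  (lab_cls l == lab_cls m) && (lab_pos l == lab_pos m).

(** A label [m] without stored parent comes from a root bag or from a child of a bag of large class.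
    The guard also keeps the lookups within the table of [l]. *)
Definition is_parent (l m : label L) : bool :=
  if lab_par m is Some (c, o) then
    (lab_cls l == c) && (lab_pos l %/ grain c + o == lab_pos m %/ grain c)
  else (2 ^ (lab_cls m %/ 16) <= lab_cls l) &&
    (lab_pos l + lab_tab l (lab_cls m) * grain (lab_cls l) <= lab_pos m
     < lab_pos l + lab_tab l (lab_cls m).+1 * grain (lab_cls l)).

Definition link (l m : label L) : bool :=
  same_node l m && lab_same l (lab_idx m) || is_parent l m && lab_up m (lab_idx l).

Definition label_adj (l m : label L) : bool := (l != m) && (link l m || link m l).

Lemma label_adj_sym : symmetric label_adj.
Proof. by move=> l m; rewrite /label_adj eq_sym orbC. Qed.

Lemma label_adj_irr : irreflexive label_adj.
Proof. by move=> l; rewrite /label_adj eqxx. Qed.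

Definition label_graph : sgraph := SGraph label_adj_sym label_adj_irr.

End LabelGraph.

(** * Embedding a forest into the label graph *)

Section Embedding.
Variables (V : finType) (par : V -> option V) (d : layout V).
Hypothesis V0 : 0 < #|V|.
Hypothesis fadj_irr : forall x, fadj par x x = false.
Hypothesis dV : valid par setT d.
Local Notation L := (trunc_log 2 #|V|).

Definition stored_parent (x : V) : option (nat * nat) :=
  if pnode d x is Some (c, p) then
    if c < 2 ^ (cls d x %/ 16) then Some (c, pos d x %/ grain c - p %/ grain c) else None
  else None.

Definition same_mask (x : V) : {ffun 'I_7 -> bool} :=
  [ffun k => [exists y, [&& cls d y == cls d x, pos d y == pos d x, inord (idx d y) == k
    & fadj par x y]]].
Definition up_mask (x : V) : {ffun 'I_7 -> bool} :=
  [ffun k => [exists y, [&& pnode d x == Some (cls d y, pos d y), inord (idx d y) == k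
    & fadj par x y]]].

Lemma layout_label x : exists l : label L,
  [/\ lab_cls l = cls d x, lab_pos l = pos d x,
    forall j, j < slots (cls d x) -> lab_tab l j = tab d x j & lab_par l = stored_parent x] /\
  [/\ lab_idx l = inord (idx d x), lab_same l = same_mask x & lab_up l = up_mask x].
Proof.
have xT := in_setT x.
have clsL : cls d x <= L by rewrite -cardsT; apply: valid_cls dV _ xT.
have div := valid_pos_dvd dV xT.
rewrite -(divnK div); apply: label_encode => //.
- rewrite ltn_divLR ?grain_gt0 // -expnD subnK; last by rewrite /rounding; lia.
  apply: leq_trans (valid_pos_lt dV xT) _.
  have := valid_len dV; have /andP[_] := trunc_log2_bounds V0.
  by rewrite cardsT expnD; nia.
- by move=> j; have [/andP[]] := valid_tab dV j xT.
- move=> c o; rewrite /stored_parent; case E: pnode => [[c' p]|//].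
  case: ifP => // hc [<- <-]; split=> //.
  have [_ hp /andP[h1 h2]] := valid_pnode dV xT E.
  apply: leq_trans (_ : 2 ^ width c' <= _); last first.
    by rewrite leq_exp2l // /width; have := slack_le hc; lia.
  rewrite -(divnK hp) mulnC -mulnDr in h2.
  by rewrite ltn_subLR ?leq_div2r // ltn_divLR ?grain_gt0 // mulnC.
Qed.

Lemma label_embedding : exists f : V -> label_graph L,
  injective f /\ forall x y, adj (f x) (f y) = fadj par x y.
Proof.
have /fin_all_exists[f fP] := layout_label.
have fc x : lab_cls (f x) = cls d x by case: (fP x) => -[].
have fp x : lab_pos (f x) = pos d x by case: (fP x) => -[].
have ft x j : j < slots (cls d x) -> lab_tab (f x) j = tab d x j.
  by case: (fP x) => -[_ _ h _] _; apply: h.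
have fpar x : lab_par (f x) = stored_parent x by case: (fP x) => -[].
have fi x : lab_idx (f x) = inord (idx d x) by case: (fP x) => _ [].
have fs x : lab_same (f x) = same_mask x by case: (fP x) => _ [].
have fu x : lab_up (f x) = up_mask x by case: (fP x) => _ [].
have inj x y : cls d x = cls d y -> pos d x = pos d y ->
    inord (idx d x) = inord (idx d y) :> 'I_7 -> x = y.
  move=> hc hp /(congr1 (@nat_of_ord _)); rewrite !inordK ?(valid_idx dV) ?in_setT //.
  by apply: (valid_inj dV); rewrite ?in_setT.
have finj : injective f.
  by move=> x y E; apply: inj; rewrite -?fc -?fp -?fi E.
exists f; split=> // x y.
have parentP a b : is_parent (f a) (f b) = (pnode d b == Some (cls d a, pos d a)).
  have [aT bT] := (in_setT a, in_setT b).
  rewrite /is_parent fpar /stored_parent !fc !fp.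
  have da := valid_pos_dvd dV aT.
  have blk : 2 ^ (cls d b %/ 16) <= cls d a ->
      (pos d a + lab_tab (f a) (cls d b) * grain (cls d a) <= pos d b <
       pos d a + lab_tab (f a) (cls d b).+1 * grain (cls d a)) = (pnode d b == Some (cls d a, pos d a)).
    move/slots_lt => h; rewrite !ft ?(ltnW h) //.
    by apply/idP/eqP => [|/(valid_block dV bT aT)//]; move/(valid_block dV bT aT).
  (* If the class of [a] is large, a parent stored in [b] has smaller class and both sides are
     false; with none stored, the table decides. *)
  have [h|h] := leqP (2 ^ (cls d b %/ 16)) (cls d a).
    case E: (pnode d b) => [[c p]|]; last by rewrite blk // E.
    case: ifP => [hc|_]; last by rewrite blk // E.
    transitivity false; first by case: eqP => // ca; move: hc h; rewrite ca; case: ltnP.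
    by apply/esym/eqP => -[ca _]; move: hc h; rewrite ca; case: ltnP.
  case E: (pnode d b) => [[c p]|] //.
  have [_ hp /andP[h1 _]] := valid_pnode dV bT E.
  case: ifP => [hc|hc]; last by apply/esym/eqP => -[ca _]; rewrite ca h in hc.
  have le := leq_div2r (grain c) h1.
  (* [pos d a] and [p] are multiples of [grain c], so equal quotients give equal positions. *)
  apply/andP/eqP => [[/eqP ca /eqP e]|[ec ep]]; last by subst c p; rewrite eqxx subnKC.
  have {}e : pos d a %/ grain c = p %/ grain c := addIn (etrans e (esym (subnKC le))).
  by rewrite -(divnK hp) -e -ca divnK.
have sameP a b : same_node (f a) (f b) && lab_same (f a) (lab_idx (f b)) =
    [&& cls d a == cls d b, pos d a == pos d b & fadj par a b].
  rewrite /same_node !fc !fp fs fi /same_mask ffunE -andbA.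
  case: eqP => //= ca; case: eqP => //= pa; apply/existsP/idP => [[z]|ab].
    by case/and4P => /eqP cz /eqP pz /eqP iz; rewrite (inj z b) // ?cz ?pz.
  by exists b; rewrite ca pa !eqxx.
have upP a b : is_parent (f a) (f b) && lab_up (f b) (lab_idx (f a)) =
    (pnode d b == Some (cls d a, pos d a)) && fadj par a b.
  rewrite parentP fu fi /up_mask ffunE; case: eqP => //= pb.
  apply/existsP/idP => [[z]|ab].
    case/and3P => /eqP; rewrite pb => -[cz pz] /eqP iz.
    by rewrite (inj z a) // /fadj orbC.
  by exists a; rewrite pb !eqxx /= /fadj orbC.
have linkP a b : link (f a) (f b) -> fadj par a b.
  by rewrite /link sameP upP => /orP[/and3P[]|/andP[]].
have sym a b : fadj par a b = fadj par b a by rewrite /fadj orbC.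
rewrite /= /label_adj; apply/andP/idP => [[_ /orP[/linkP|/linkP]]|xy]; rewrite 1?sym //.
have nxy : x != y by apply: contraTneq xy => ->; rewrite fadj_irr.
split; first by apply: contraNneq nxy => /finj->.
rewrite /link !sameP !upP (sym y x) xy !andbT.
case: (valid_edge dV (in_setT x) (in_setT y) xy) => [[-> ->]|->|->].
- by rewrite !eqxx.
- by rewrite eqxx !orbT.
- by rewrite eqxx !orbT.
Qed.
End Embedding.

Lemma forest_universal : exists K, forall n, exists G : sgraph, #|G| <= K * n /\
  forall (V : finType) (e : rel V), #|V| = n -> symmetric e -> irreflexive e ->
    (forall c, 2 < size c -> ~ ucycle e c) ->
    exists f : V -> G, injective f /\ forall x y, adj (f x) (f y) = e x y.
Proof.
have [K hK] := card_label; exists K => n.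
have [->|n0] := posnP n.
  exists (@SGraph 'I_0 (fun _ _ => false) (fun _ _ => erefl) (fun _ => erefl)).
  split=> [|V e V0 _ _ _]; first by rewrite card_ord.
  have noV (x : V) : False by have := card0_eq V0 x.
  by exists (fun x => False_rect _ (noV x)); split=> x; case: (noV x).
exists (label_graph (trunc_log 2 n)); split=> [|V e Vn esym eirr acy]; first exact: hK.
have [par [rk [eE rkP]]] := acyclic_rooted esym eirr acy.
have pT : piece par setT.
  split; last first.
    by rewrite setCT (_ : [set _ in _ | _] = set0) ?cards0 //; apply/setP => z; rewrite !inE.
  rewrite (_ : [set _ in _ | _] = set0) ?cards0 //; apply/setP => z; rewrite !inE /=.
  by apply/negbTE/negP => /par_inP[y _]; rewrite !inE.
have [d dV] := layout_exists rkP pT ltac:(by rewrite -card_gt0 cardsT Vn).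
have firr x : fadj par x x = false by rewrite /fadj -eE eirr.
subst n; have [f [finj fE]] := label_embedding n0 firr dV.
by exists f; split=> // x y; rewrite fE eE.
Qed.

(** * Graphs of bounded arboricity *)

Lemma arboricity_cover (k : nat) (H : sgraph) : has_arboricity k H ->
  exists e : 'I_k -> rel H,
    [/\ forall i, symmetric (e i), forall i, irreflexive (e i),
      forall i c, 2 < size c -> ~ ucycle (e i) c &
      forall x y, adj x y = [exists i, e i x y]].
Proof.
case=> P [partP Pk acyP].
(* Indices past the number of blocks get the default [set0], an empty forest. *)
pose F (i : 'I_k) := nth set0 (enum P) i.
have FP i : F i = set0 \/ F i \in P.
  have [iP|iP] := ltnP i (size (enum P)); last by left; rewrite /F nth_default.
  by right; rewrite -mem_enum mem_nth.
have Fadj i x y : [set x; y] \in F i -> adj x y.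
  case: (FP i) => [->|FiP]; first by rewrite inE.
  move=> xyF; have: [set x; y] \in edges H.
    by rewrite -(cover_partition partP); apply/bigcupP; exists (F i).
  rewrite inE => /existsP[a /existsP[b /andP[/eqP E ab]]].
  have ax : a \in [set x; y] by rewrite E !inE eqxx.
  have bx : b \in [set x; y] by rewrite E !inE eqxx orbT.
  have nab : a != b by apply: contraTneq ab => ->; rewrite adj_irr.
  move: ax bx; rewrite !inE => /orP[]/eqP ea /orP[]/eqP eb; subst a b.
  - by rewrite eqxx in nab.
  - by [].
  - by rewrite adj_sym.
  - by rewrite eqxx in nab.
exists (fun i x y => [set x; y] \in F i); split.
- by move=> i x y; rewrite setUC.
- by move=> i x; apply/negP => /Fadj; rewrite adj_irr.
- move=> i c c2; case: (FP i) => [E|/acyP]; last by apply.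
  case: c c2 => [|x [|y c]] // _ /andP[/= /andP[]]; by rewrite E inE.
- move=> x y; apply/idP/existsP => [xy|[i /Fadj//]].
  have: [set x; y] \in cover P.
    rewrite (cover_partition partP) inE; apply/existsP; exists x; apply/existsP; exists y.
    by rewrite eqxx.
  case/bigcupP => X XP xyX.
  have Xs : index X (enum P) < size (enum P) by rewrite index_mem mem_enum.
  have Xk : index X (enum P) < k by apply: leq_trans Xs _; rewrite -cardE.
  by exists (Ordinal Xk); rewrite /F /= nth_index // mem_enum.
Qed.

Section Union.
Variables (k : nat) (G : sgraph).

Definition union_adj (u v : {ffun 'I_k -> G}) : bool := [exists i, adj (u i) (v i)].

Lemma union_adj_sym : symmetric union_adj.
Proof. by move=> u v; apply: eq_existsb => i; rewrite adj_sym. Qed.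

Lemma union_adj_irr : irreflexive union_adj.
Proof. by move=> u; apply/existsP => -[i]; rewrite adj_irr. Qed.

Definition union_graph : sgraph := SGraph union_adj_sym union_adj_irr.
End Union.

Lemma isomorphic_induced (H G : sgraph) (f : H -> G) :
  injective f -> (forall x y, adj (f x) (f y) = adj x y) ->
  exists A : {set G}, isomorphic H (induced A).
Proof.
move=> finj fE; exists [set f x | x : H].
have fA x : f x \in [set f x | x : H] by apply: imset_f.
exists (fun x => exist _ (f x) (fA x)) => //.
apply: inj_card_bij => [x y [/finj//]|].
by rewrite card_sig card_imset.
Qed.

Theorem theorem3 (k : nat) (hk : 1 <= k) :
  exists C : nat, forall n : nat, exists G : sgraph,
    #|G| <= C * n ^ k /\
    forall H : sgraph, #|H| = n -> has_arboricity k H ->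
      exists A : {set G}, isomorphic H (induced A).
Proof.
have [K hK] := forest_universal; exists (K ^ k) => n.
have [G [cG uG]] := hK n; exists (union_graph k G); split.
  by rewrite card_ffun card_ord -expnMn leq_exp2r.
move=> H Hn /arboricity_cover[e [esym eirr eacy eE]].
have /fin_all_exists[f fP] : forall i, exists f : H -> G,
    injective f /\ forall x y, adj (f x) (f y) = e i x y.
  by move=> i; apply: (uG _ _ Hn (esym i) (eirr i) (eacy i)).
apply: (@isomorphic_induced H (union_graph k G) (fun x => [ffun i => f i x])).
  (* As [k] is positive there is a coordinate 0, and injectivity there suffices. *)
  by move=> x y /ffunP/(_ (Ordinal hk)); rewrite !ffunE; case: (fP (Ordinal hk)) => h _ /h.
move=> x y; rewrite eE; apply: eq_existsb => i; rewrite !ffunE.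
by case: (fP i).
Qed.
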